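(* Let $n,k\ge 1$ be integers and let $X$ be an isotropic random vector in $\mathbb{R}^n$. Assume that linear forms satisfy the following small-ball condition: there is some $\lambda>0$ for which $$\Pr\big(|\langle x,X\rangle|\ge \lambda\|x\|_{\ell_2^n}\big)\ge 99/100\quad\text{for every } x\in\mathbb{R}^n.$$ Let $X_1,\dots,X_k$ be independent copies of $X$ and let $\Gamma:\mathbb{R}^n\to\mathbb{R}^k$ be the random matrix $\Gamma=k^{-1/2}\sum_{i=1}^k\langle X_i,\cdot\rangle e_i$. Then there exists a constant $c$ that depends only on $\lambda$ such that, for a convex body $T\subset\mathbb{R}^n$, with probability at least $3/4$, $$\operatorname{diam}\big(T\cap\ker(\Gamma)\big)\le \frac{c}{\sqrt{k}}\cdot\max\Big\{\mathbb{E}\|G\|_{T^\circ},\ \mathbb{E}\Big\|k^{-1/2}\sum_{i=1}^k X_i\Big\|_{T^\circ}\Big\},$$ where $\operatorname{diam}$ denotes the Euclidean ($\ell_2^n$) diameter.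
   Context: A random vector $X$ in $\mathbb{R}^n$ (with distribution $\mu$) is called isotropic if $\mu$ is symmetric (i.e. $X$ and $-X$ have the same distribution) and $\mathbb{E}\langle x,X\rangle^2=\|x\|_{\ell_2^n}^2$ for every $x\in\mathbb{R}^n$. A convex body is a convex, centrally-symmetric subset of $\mathbb{R}^n$ with non-empty interior. $(e_i)_{i=1}^k$ is the standard basis of $\mathbb{R}^k$. For $y\in\mathbb{R}^n$, $\|y\|_{T^\circ}=\sup_{t\in T}|\langle y,t\rangle|$. $G=(g_1,\dots,g_n)$ denotes the standard Gaussian vector in $\mathbb{R}^n$, so $\mathbb{E}\|G\|_{T^\circ}=\mathbb{E}\sup_{t\in T}|\langle G,t\rangle|$. *)

(* Defs.v *)
(* Vectors of R^n are n.-tuple R (which carries the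
   product sigma-algebra of Borel sets, i.e. the Borel sigma-algebra of R^n). *)
From HB Require Import structures.
From mathcomp Require Import all_boot all_order all_algebra.
From mathcomp Require Import all_classical all_reals all_analysis.
Set Implicit Arguments. Unset Strict Implicit. Unset Printing Implicit Defensive.
Import Order.TTheory GRing.Theory Num.Theory.
Import numFieldNormedType.Exports.
Local Open Scope classical_set_scope.
Local Open Scope ring_scope.

Section Defs.
Variable R : realType.

Definition dotv n (x y : n.-tuple R) : R := \sum_(j < n) tnth x j * tnth y j.
Definition norm2 n (x : n.-tuple R) : R := Num.sqrt (dotv x x).
Definition addv n (x y : n.-tuple R) : n.-tuple R := [tuple tnth x j + tnth y j | j < n].
Definition oppv n (x : n.-tuple R) : n.-tuple R := [tuple - tnth x j | j < n].
Definition scalev n (a : R) (x : n.-tuple R) : n.-tuple R := [tuple a * tnth x j | j < n].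
Definition zerov n : n.-tuple R := [tuple 0 | j < n].

Definition l2diam n (S : set (n.-tuple R)) : \bar R :=
  ereal_sup [set (norm2 (addv x (oppv y)))%:E | x in S & y in S].

Definition polar_norm_T n (T : set (n.-tuple R)) (y : n.-tuple R) : \bar R :=
  ereal_sup [set (`|dotv y t|)%:E | t in T].

Definition convex_body n (T : set (n.-tuple R)) : Prop :=
  [/\ (forall x y (t : R), T x -> T y -> 0 <= t -> t <= 1 ->
         T (addv (scalev t x) (scalev (1 - t) y))),
      (forall x, T x -> T (oppv x)) &
      (exists x r, 0 < r /\ forall y, norm2 (addv y (oppv x)) < r -> T y)].

Section Prob.
Context {d} {Omega : measurableType d} (P : probability Omega R).

Definition same_law n (X Y : Omega -> n.-tuple R) : Prop :=
  forall A : set (n.-tuple R), measurable A -> P (X @^-1` A) = P (Y @^-1` A).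

Definition isotropic n (X : {RV P >-> n.-tuple R}) : Prop :=
  same_law X (fun w => oppv (X w)) /\
  forall x : n.-tuple R,
    (\int[P]_w ((dotv x (X w)) ^+ 2)%:E)%E = ((norm2 x) ^+ 2)%:E.

Definition mutually_independent n k (Xs : 'I_k -> {RV P >-> n.-tuple R}) : Prop :=
  forall B : 'I_k -> set (n.-tuple R), (forall i, measurable (B i)) ->
    P [set w | forall i, B i (Xs i w)] = (\prod_(i < k) P (Xs i @^-1` B i))%E.

Definition std_gaussian n (G : {RV P >-> n.-tuple R}) : Prop :=
  forall B : 'I_n -> set R, (forall j, measurable (B j)) ->
    P [set w | forall j, B j (tnth (G w) j)] =
      (\prod_(j < n) normal_prob 0 1 (B j))%E.
End Prob.

Definition Gamma n k (Xs : 'I_k -> n.-tuple R) (y : n.-tuple R) : k.-tuple R :=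
  [tuple (Num.sqrt k%:R)^-1 * dotv (Xs i) y | i < k].

Definition kerGamma n k (Xs : 'I_k -> n.-tuple R) : set (n.-tuple R) :=
  [set y | Gamma Xs y = zerov k].

Definition normalized_sum n k (Xs : 'I_k -> n.-tuple R) : n.-tuple R :=
  [tuple (Num.sqrt k%:R)^-1 * \sum_(i < k) tnth (Xs i) j | j < n].

End Defs.

(* Main.v *)
(* The second term of the maximum suffices.  Let [S] be the set of points of
   [T] of norm at least [r], and put [delta = lambda r].  A cutoff [phi], equal
   to 0 on [|u| <= delta / 2] and to 1 on [|u| >= delta], satisfies
   [E phi(<t, X>) >= 99/100] on [S] by the small-ball condition.  If some [t]
   in [S] lay in the kernel, the centred sum [sum_i (E phi - phi(<t, X_i>))]
   would be at least [99 k / 100].  But by symmetrization and contraction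
   the expected supremum over [S] of this sum is at most [4 / delta] times the
   expectation of [sup_T |<t, sum_i X_i>|], the signs being absorbed by the
   symmetry of [X].  Markov's inequality then excludes [S] from the kernel as
   soon as [r] exceeds a multiple of [E ||k^(-1/2) sum_i X_i|| / (lambda sqrt k)].
   Suprema are taken over finite sets first, then over a dense sequence. *)
Require Import Defs.
From HB Require Import structures.
From mathcomp Require Import all_boot all_order all_algebra.
From mathcomp Require Import all_classical all_reals all_analysis.
From mathcomp Require Import measurable_realfun ring lra.
Import Order.TTheory GRing.Theory Num.Theory.
Import Defs.
Local Open Scope classical_set_scope.
Local Open Scope ring_scope.

Set Implicit Arguments. Unset Strict Implicit. Unset Printing Implicit Defensive.

(** * Independence and integrals *)

(** The joint law of [(X, Y)] agrees with the product of the two laws on rectangles, hence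
    everywhere; Tonelli's theorem then gives the iterated integral. *)
Lemma integral_independent_pair d d1 d2 (Omega : measurableType d)
    (T1 : measurableType d1) (T2 : measurableType d2) (R : realType)
    (P : probability Omega R) (X : {mfun Omega >-> T1}) (Y : {mfun Omega >-> T2})
    (f : T1 * T2 -> \bar R) :
  (forall A B, measurable A -> measurable B ->
     P (X @^-1` A `&` Y @^-1` B) = (P (X @^-1` A) * P (Y @^-1` B))%E) ->
  measurable_fun setT f -> (forall z, 0 <= f z)%E ->
  (\int[P]_w f (X w, Y w) = \int[P]_w \int[P]_w' f (X w', Y w))%E.
Proof.
move=> indep mf f0.
pose h w := (X w, Y w).
have mh : measurable_fun setT h.
  by apply: measurable_fun_pair; exact: measurable_funP.
transitivity (\int[pushforward P h]_z f z)%E.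
  by rewrite ge0_integral_pushforward// => ? _; exact: f0.
pose m1 : {measure set (T1 * T2) -> \bar R} :=
  measure_function_pushforward__canonical__measure_function_Measure P mh.
rewrite (@eq_measure_integral _ _ _ _
    (distribution P X \x distribution P Y)%E m1); last first.
  by move=> C mC _; apply/esym/product_measure_unique => // A B mA mB;
    rewrite /= /pushforward -indep.
rewrite fubini_tonelli2// ge0_integral_pushforward//; last 2 first.
- exact: measurable_fun_fubini_tonelli_G.
- by move=> y _; apply: integral_ge0.
apply: eq_integral => w _ /=.
rewrite /fubini_G ge0_integral_pushforward//.
by apply: measurableT_comp => //; exact: pair2_measurable.
Qed.

Section independent_coordinate.
Context d d' (Omega : measurableType d) (E : measurableType d') (R : realType)
  (P : probability Omega R) (k : nat) (Xs : 'I_k -> {mfun Omega >-> E}).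

(** Overwriting coordinate [j] by the constant [point] removes the dependence on [Xs j] while the
    rest of the sample stays in a tuple of the same length [k]. *)
Definition mask_coord (j : 'I_k) (w : Omega) : k.-tuple E :=
  [tuple if i == j then point else Xs i w | i < k].

Lemma measurable_mask_coord j : measurable_fun setT (mask_coord j).
Proof.
apply/measurable_fun_tnthP => i.
rewrite (_ : _ \o _ = if i == j then cst point else Xs i).
  by case: ifP => _; [exact: measurable_cst|exact: measurable_funP].
by apply/funext => w /=; rewrite tnth_mktuple; case: ifP.
Qed.

HB.instance Definition _ j :=
  isMeasurableFun.Build _ _ _ _ (mask_coord j) (measurable_mask_coord j).

(** A generating pi-system of the product sigma-algebra, on which mutual independence can be applied
    directly. *)
Definition tuple_rectangles : set (set (k.-tuple E)) :=
  [set B | exists2 A : 'I_k -> set E, (forall i, measurable (A i)) &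
    B = [set y | forall i, A i (tnth y i)]].

Lemma measurable_tuple_rectangles :
  @measurable _ (k.-tuple E) = <<s tuple_rectangles >>.
Proof.
apply/seteqP; split; apply: smallest_sub.
- exact: smallest_sigma_algebra.
- move=> B; rewrite -bigcup_seq/= => -[i _ [A mA]]; rewrite setTI => <-.
  apply: sub_sigma_algebra; exists (fun j => if j == i then A else setT).
    by move=> j; case: ifP.
  apply/seteqP; split => [y Ay j|y /(_ i)/=]; last by rewrite eqxx.
  by case: eqP => // ->.
- exact: sigma_algebra_measurable.
- move=> _ [A mA ->].
  rewrite (_ : [set _ | _] =
      \bigcap_(i in [set: 'I_k]) ((@tnth _ E ^~ i) @^-1` A i)); last first.
    by apply/seteqP; split => [y Ay i _|y Ay i]; exact: Ay.
  apply: fin_bigcap_measurable => // i _.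
  by rewrite -[X in measurable X]setTI; apply: measurable_tnth.
Qed.

Hypothesis indep : forall B : 'I_k -> set E, (forall i, measurable (B i)) ->
  P [set w | forall i, B i (Xs i w)] = (\prod_(i < k) P (Xs i @^-1` B i))%E.

(** Mutual independence gives the product formula when [B] is a rectangle; for fixed [A] both sides
    are finite measures in [B], so agreement on this pi-system extends to all measurable sets. *)
Lemma independent_mask_coord j (A : set E) (B : set (k.-tuple E)) :
  measurable A -> measurable B ->
  P (Xs j @^-1` A `&` mask_coord j @^-1` B) =
  (P (Xs j @^-1` A) * P (mask_coord j @^-1` B))%E.
Proof.
move=> mA mB.
have mXA : measurable (Xs j @^-1` A) by exact: measurable_funPTI.
have mindep (C : 'I_k -> set E) : (forall i, measurable (C i)) ->
    P (Xs j @^-1` A `&` mask_coord j @^-1` [set y | forall i, C i (tnth y i)]) =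
    (P (Xs j @^-1` A) * P (mask_coord j @^-1` [set y | forall i, C i (tnth y i)]))%E.
  move=> mC.
  (* The masked coordinate is always [point]: if [C j] misses it, the preimage is empty; otherwise
     coordinate [j] imposes no condition, so its slot is free to hold [A] or [setT]. *)
  have [Cj|nCj] := pselect (C j point); last first.
    rewrite (_ : mask_coord j @^-1` _ = set0) ?setI0 ?measure0 ?mule0//.
    rewrite -subset0 => w /(_ j); by rewrite tnth_mktuple eqxx.
  have mif (D : set E) i : measurable D -> measurable (if i == j then D else C i).
    by case: ifP.
  rewrite (_ : _ `&` _ = [set w | forall i, (if i == j then A else C i) (Xs i w)]).
    rewrite (_ : mask_coord j @^-1` _ =
        [set w | forall i, (if i == j then setT else C i) (Xs i w)]).
      rewrite (@indep (fun i => if i == j then A else C i)); last by move=> i; exact: mif.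
      rewrite (@indep (fun i => if i == j then setT else C i)); last by move=> i; exact: mif.
      rewrite (bigD1 j)//= [in RHS](bigD1 j)//= !eqxx preimage_setT probability_setT.
      rewrite mul1e; congr (_ * _)%E; apply: eq_bigr => i /negbTE ->//.
    apply/seteqP; split => w /= h i; move: (h i); rewrite tnth_mktuple;
      by case: eqP => // ->.
  apply/seteqP; split => w /= => [[Aw h] i|h].
    by move: (h i); rewrite tnth_mktuple; case: eqP => // ->.
  split; first by move: (h j); rewrite eqxx.
  by move=> i; move: (h i); rewrite tnth_mktuple; case: eqP => // ->.
pose p := fine (P (Xs j @^-1` A)).
have pE : P (Xs j @^-1` A) = p%:E by rewrite fineK// fin_num_measure.
have p0 : 0 <= p by rewrite fine_ge0.
rewrite pE setIC.
(* The two measures compared: the image under [mask_coord j] of [P] restricted to the event on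
   [Xs j], and the law of the masked sample scaled by [p]. *)
have mW : measurable_fun setT (mask_coord j) by exact: measurable_funP.
pose m1 : {measure set (k.-tuple E) -> \bar R} :=
  measure_function_pushforward__canonical__measure_function_Measure (mrestr P mXA) mW.
pose m2 : {measure set (k.-tuple E) -> \bar R} :=
  mscale (NngNum p0) (distribution P (mask_coord j)).
apply: (@measure_unique _ R _ tuple_rectangles (fun=> setT)
  measurable_tuple_rectangles _ _ _ m1 m2 _ _ B mB).
- move=> _ _ [C mC ->] [D mD ->]; exists (fun i => C i `&` D i).
    by move=> i; exact: measurableI.
  by apply/seteqP; split => [y [Cy Dy] i|y CDy]; [split|split => i; case: (CDy i)].
- move=> _; exists (fun=> setT) => //.
  by apply/seteqP; split.
- by rewrite -subTset => w _; exists 0%N.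
- by move=> _ [C mC ->]; rewrite /m1 /m2/= /pushforward /mrestr /mscale/= setIC -pE -mindep.
- move=> _; rewrite /m1/= /pushforward /mrestr preimage_setT setTI.
  by rewrite -ge0_fin_numE ?fin_num_measure.
Qed.

End independent_coordinate.

(* Unlike [ge0_le_integral], this needs no measurability: the integral of a
   nonnegative function is a supremum over the simple functions below it. *)
Lemma ge0_integral_mono d (T : measurableType d) (R : realType)
    (mu : {measure set T -> \bar R}) (f g : T -> \bar R) :
  (forall x, 0 <= f x)%E -> (forall x, f x <= g x)%E ->
  (\int[mu]_x f x <= \int[mu]_x g x)%E.
Proof.
move=> f0 fg; have g0 x : (0 <= g x)%E by exact: le_trans (f0 x) (fg x).
rewrite !ge0_integralTE//; apply: ereal_sup_le => _ [h hf <-].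
by exists h => // x; exact: le_trans (hf x) (fg x).
Qed.

Lemma integral_prob_cst d (T : measurableType d) (R : realType)
  (P : probability T R) (r : R) : (\int[P]_w r%:E = r%:E)%E.
Proof. by rewrite -[RHS]mule1 -(probability_setT P) -integral_cst. Qed.

(** * Finite maxima: convexity and contraction *)

Section positive_max.
Context {R : realType} {N : nat}.
Implicit Types f g : 'I_N -> R.

(* The base value 0 keeps every integrand nonnegative, so that no integrability
   is ever required. *)
Definition pmax f : R := \big[Num.max/0]_(t < N) f t.

Lemma pmax_ge0 f : 0 <= pmax f.
Proof. by rewrite /pmax; elim/big_rec: _ => // t x _ x0; rewrite le_max x0 orbT. Qed.

Lemma le_pmax f t : f t <= pmax f.
Proof. by rewrite /pmax (bigD1 t)//= le_max lexx. Qed.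

Lemma pmax_le f c : 0 <= c -> (forall t, f t <= c) -> pmax f <= c.
Proof.
by move=> c0 fc; rewrite /pmax; elim/big_rec: _ => // t x _ xc; rewrite ge_max fc.
Qed.

Lemma pmax_attained f : pmax f = 0 \/ exists t, pmax f = f t.
Proof.
rewrite /pmax; elim/big_rec: _ => [|t x _ IH]; first by left.
by case: (leP (f t) x) => _; [exact: IH|right; exists t].
Qed.

Lemma measurable_pmax d (T : measurableType d) (h : 'I_N -> T -> R) :
  (forall t, measurable_fun setT (h t)) ->
  measurable_fun setT (fun x => pmax (h ^~ x)).
Proof.
move=> mh; rewrite /pmax.
elim: (index_enum _) => [|t s IH].
  by under eq_fun do rewrite big_nil; exact: measurable_cst.
by under eq_fun do rewrite big_cons; exact: measurable_maxr.
Qed.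

(** The family [a + (m - p)] is the midpoint of the two families on the right, and a maximum is
    convex. *)
Lemma pmax_convex (a m p : 'I_N -> R) :
  2 * pmax (fun t => a t + (m t - p t)) <=
  pmax (fun t => a t + 2 * m t) + pmax (fun t => a t - 2 * p t).
Proof.
have [->|[t ->]] := pmax_attained (fun t => a t + (m t - p t)).
  by rewrite mulr0 addr_ge0// pmax_ge0.
have := le_pmax (fun t => a t + 2 * m t) t.
have /= := le_pmax (fun t => a t - 2 * p t) t; lra.
Qed.

(** A two-point contraction principle. With [t] and [s] maximal on the left, [2 * (p t - p s)] is at
    most [v t - v s] or its opposite; according to the sign, [t] is used in the [a + v] maximum and
    [s] in the [a - v] one, or conversely. *)
Lemma pmax_contraction (a p v : 'I_N -> R) :
  (forall t, 2 * `|p t| <= `|v t|) ->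
  (forall t s, 2 * `|p t - p s| <= `|v t - v s|) ->
  pmax (fun t => a t + 2 * p t) + pmax (fun t => a t - 2 * p t) <=
  pmax (fun t => a t + v t) + pmax (fun t => a t - v t).
Proof.
move=> pv0 pv.
have lep := le_pmax (fun t => a t + v t); have lem := le_pmax (fun t => a t - v t).
have p0 := pmax_ge0 (fun t => a t + v t); have m0 := pmax_ge0 (fun t => a t - v t).
(* The base value 0 behaves like one more index at which [a], [p] and [v] vanish; the hypothesis on
   a single [t] is the Lipschitz condition against that index. *)
have [->|[t ->]] := pmax_attained (fun t => a t + 2 * p t);
have [->|[s ->]] := pmax_attained (fun t => a t - 2 * p t).
- by rewrite addr0 addr_ge0.
- have := pv0 s; have := lep s; have := lem s; have := ler_norm (- p s).
  by rewrite normrN; case: (ger0P (v s)) => /=; lra.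
- have := pv0 t; have := lep t; have := lem t; have := ler_norm (p t).
  by case: (ger0P (v t)) => /=; lra.
- have := pv t s; have := lep t; have := lem t; have := lep s; have := lem s.
  have := ler_norm (p t - p s).
  by case: (ger0P (v t - v s)) => /=; lra.
Qed.

End positive_max.

(** * Symmetrization for one sample member *)

(** The maximum on the left is attained at one [t], or is 0, and the integrand on the right
    dominates its value at that same [t]. *)
Lemma pmax_jensen d (Omega : measurableType d) (R : realType)
    (P : probability Omega R) (N : nat) (a m : 'I_N -> R)
    (p : 'I_N -> Omega -> R) :
  (forall t, measurable_fun setT (p t)) -> (forall t w, 0 <= p t w) ->
  (forall t, \int[P]_w (p t w)%:E = (m t)%:E)%E ->
  ((pmax (fun t => a t + 2 * m t))%:E <=
   \int[P]_w (pmax (fun t => a t + 2 * p t w))%:E)%E.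
Proof.
move=> mp p0 pm.
have [->|[t ->]] := pmax_attained (fun t => a t + 2 * m t).
  by apply: integral_ge0 => w _; rewrite lee_fin pmax_ge0.
have mmax : measurable_fun setT (fun w => pmax (fun t => a t + 2 * p t w)).
  apply: measurable_pmax => s; apply: measurable_funD; first exact: measurable_cst.
  by apply: measurable_funM => //; exact: measurable_cst.
(* Since [a t] may be negative, adding its absolute value to both sides keeps every integrand
   nonnegative. *)
rewrite -(@leeD2lE _ `|a t|%:E)//.
rewrite -{2}(integral_prob_cst P `|a t|) -ge0_integralD//; last 2 first.
- by move=> w _; rewrite lee_fin pmax_ge0.
- exact/measurable_EFinP.
have -> : (`|a t|%:E + (a t + 2 * m t)%:E =
    \int[P]_w ((`|a t| + a t)%:E + 2%:E * (p t w)%:E))%E.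
  have aa : 0 <= `|a t| + a t by have := ler_norm (- a t); rewrite normrN; lra.
  rewrite ge0_integralD//; last 2 first.
  - by move=> w _; rewrite -EFinM lee_fin mulr_ge0.
  - by apply: measurable_funeM; exact/measurable_EFinP.
  rewrite ge0_integralZl_EFin//; last 2 first.
  - by move=> w _; rewrite lee_fin.
  - exact/measurable_EFinP.
  by rewrite integral_prob_cst pm -EFinM -!EFinD addrA.
apply: ge0_integral_mono => w.
  rewrite -EFinM -EFinD lee_fin addr_ge0//; last by rewrite mulr_ge0.
  by have := ler_norm (- a t); rewrite normrN; lra.
rewrite -EFinM -!EFinD lee_fin -addrA lerD2l.
exact: (le_pmax (fun t => a t + 2 * p t w)).
Qed.

(* Symmetrization and contraction are done at once, without a ghost sample:
   [m - p] is the midpoint of [2 m] and [- 2 p], and Jensen's inequality turns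
   [2 m] back into [2 p]. *)
Lemma symmetrization_step d (Omega : measurableType d) (R : realType)
    (P : probability Omega R) (N : nat) (a m : 'I_N -> R)
    (p v : 'I_N -> Omega -> R) :
  (forall t, measurable_fun setT (p t)) -> (forall t, measurable_fun setT (v t)) ->
  (forall t w, 0 <= p t w) ->
  (forall t, \int[P]_w (p t w)%:E = (m t)%:E)%E ->
  (forall t w, 2 * `|p t w| <= `|v t w|) ->
  (forall t s w, 2 * `|p t w - p s w| <= `|v t w - v s w|) ->
  (\int[P]_w (pmax (fun t => a t - v t w))%:E =
   \int[P]_w (pmax (fun t => a t + v t w))%:E)%E ->
  (\int[P]_w (pmax (fun t => a t + (m t - p t w)))%:E <=
   \int[P]_w (pmax (fun t => a t + v t w))%:E)%E.
Proof.
move=> mp mv p0 pm pv0 pv sym.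
have mmax (h : 'I_N -> Omega -> R) : (forall t, measurable_fun setT (h t)) ->
    measurable_fun setT (fun w => (pmax (h ^~ w))%:E).
  by move=> mh; apply/measurable_EFinP; exact: measurable_pmax.
have m2p t : measurable_fun setT (fun w => 2 * p t w).
  by apply: measurable_funM => //; exact: measurable_cst.
have ma (h : 'I_N -> Omega -> R) : (forall t, measurable_fun setT (h t)) ->
    measurable_fun setT (fun w => (pmax (fun t => a t + h t w))%:E).
  move=> mh; apply: (mmax (fun t w => a t + h t w)) => t.
  by apply: measurable_funD => //; exact: measurable_cst.
have map := ma _ m2p; have mav := ma _ mv.
have mam : measurable_fun setT (fun w => (pmax (fun t => a t - 2 * p t w))%:E).
  by apply: (ma (fun t w => - (2 * p t w))) => t; exact: measurableT_comp.
have mavm : measurable_fun setT (fun w => (pmax (fun t => a t - v t w))%:E).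
  by apply: (ma (fun t w => - v t w)) => t; exact: measurableT_comp.
have mpm : measurable_fun setT (fun w => (pmax (fun t => a t + (m t - p t w)))%:E).
  apply: (ma (fun t w => m t - p t w)) => t.
  by apply: measurable_funB => //; exact: measurable_cst.
(* After doubling, [sym] turns the right side into the sum of the [a + v] and [a - v] integrals.
   Contraction bounds it below by the [a + 2 p] and [a - 2 p] integrals, Jensen replaces the first
   by the constant with [2 m], and convexity closes the chain. *)
rewrite -(@lee_pmul2l _ 2%:E)// -[X in (_ <= X)%E]ge0_integralZl_EFin//; last first.
  by move=> w _; rewrite lee_fin pmax_ge0.
rewrite -ge0_integralZl_EFin//; last by move=> w _; rewrite lee_fin pmax_ge0.
have -> : (\int[P]_w (2%:E * (pmax (fun t => a t + v t w))%:E) =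
    \int[P]_w ((pmax (fun t => a t + v t w))%:E + (pmax (fun t => a t - v t w))%:E))%E.
  rewrite ge0_integralD//; try by move=> w _; rewrite lee_fin pmax_ge0.
  rewrite sym ge0_integralZl_EFin//; last by move=> w _; rewrite lee_fin pmax_ge0.
  by rewrite -[2]/(1 + 1)%R EFinD ge0_muleDl// mul1e.
apply: (@le_trans _ _ (\int[P]_w ((pmax (fun t => a t + 2 * p t w))%:E +
    (pmax (fun t => a t - 2 * p t w))%:E))%E); last first.
  apply: ge0_integral_mono => w; rewrite -?EFinD lee_fin.
    by rewrite addr_ge0// pmax_ge0.
  by apply: (@pmax_contraction _ _ a (p ^~ w) (v ^~ w)) => [t|t s]; [exact: pv0|exact: pv].
rewrite ge0_integralD//; try by move=> w _; rewrite lee_fin pmax_ge0.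
apply: (@le_trans _ _ ((pmax (fun t => a t + 2 * m t))%:E +
    \int[P]_w (pmax (fun t => a t - 2 * p t w))%:E)%E); last first.
  by rewrite leeD2r// pmax_jensen.
rewrite -[X in (X + _)%E](integral_prob_cst P) -ge0_integralD//; last 2 first.
- by move=> w _; rewrite lee_fin pmax_ge0.
- by move=> w _; rewrite lee_fin pmax_ge0.
apply: ge0_integral_mono => w; rewrite -?EFinM -?EFinD lee_fin.
  by rewrite mulr_ge0// pmax_ge0.
exact: (pmax_convex a m (p ^~ w)).
Qed.

(** * Replacement of the sample members one at a time *)

Section process_comparison.
Context d d' (Omega : measurableType d) (E : measurableType d') (R : realType)
  (P : probability Omega R) (k N : nat) (Xs : 'I_k -> {mfun Omega >-> E})
  (m : 'I_N -> R) (p v : 'I_N -> E -> R).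
Hypothesis indep : forall B : 'I_k -> set E, (forall i, measurable (B i)) ->
  P [set w | forall i, B i (Xs i w)] = (\prod_(i < k) P (Xs i @^-1` B i))%E.
Hypothesis mp : forall t, measurable_fun setT (p t).
Hypothesis mv : forall t, measurable_fun setT (v t).
Hypothesis p_ge0 : forall t x, 0 <= p t x.
Hypothesis pm : forall i t, (\int[P]_w (p t (Xs i w))%:E = (m t)%:E)%E.
Hypothesis pv0 : forall t x, 2 * `|p t x| <= `|v t x|.
Hypothesis pv : forall t s x, 2 * `|p t x - p s x| <= `|v t x - v s x|.
Hypothesis sym : forall i a,
  (\int[P]_w (pmax (fun t => a t - v t (Xs i w)))%:E =
   \int[P]_w (pmax (fun t => a t + v t (Xs i w)))%:E)%E.

Let hybrid_term (l i : nat) (t : 'I_N) (x : E) : R :=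
  if (i < l)%N then v t x else m t - p t x.

Let measurable_hybrid_term l i t : measurable_fun setT (hybrid_term l i t).
Proof.
rewrite /hybrid_term; case: (i < l)%N; first exact: mv.
by apply: measurable_funB => //; exact: measurable_cst.
Qed.

(* Lindeberg-style interpolation: the first [l] members are already replaced. *)
Let hybrid (l : nat) : \bar R :=
  (\int[P]_w (pmax (fun t => \sum_(i < k) hybrid_term l i t (Xs i w)))%:E)%E.

(** The terms with [i != j] depend on the masked sample only, which is independent of [Xs j]; so
    [Xs j] can be integrated first with the rest frozen. *)
Let hybrid_split l (j : 'I_k) (h : 'I_N -> E -> R) :
  (forall t, measurable_fun setT (h t)) ->
  (\int[P]_w (pmax (fun t =>
     (\sum_(i < k | i != j) hybrid_term l i t (Xs i w)) + h t (Xs j w)))%:E =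
   \int[P]_w \int[P]_w' (pmax (fun t =>
     (\sum_(i < k | i != j) hybrid_term l i t (Xs i w)) + h t (Xs j w')))%:E)%E.
Proof.
move=> mh.
pose a t (y : k.-tuple E) := \sum_(i < k | i != j) hybrid_term l i t (tnth y i).
have aE t w : \sum_(i < k | i != j) hybrid_term l i t (Xs i w) =
    a t (mask_coord Xs j w).
  by apply: eq_bigr => i /negbTE ij; rewrite tnth_mktuple ij.
pose f (z : E * k.-tuple E) := (pmax (fun t => a t z.2 + h t z.1))%:E.
under eq_integral => w _ do under eq_fun => t do rewrite aE.
under [RHS]eq_integral => w _ do
  under eq_integral => w' _ do under eq_fun => t do rewrite aE.
apply: (@integral_independent_pair _ _ _ _ _ _ _ P (Xs j)
  (mask_coord Xs j) f).
- by move=> A B mA mB; exact: independent_mask_coord.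
- apply/measurable_EFinP; apply: (measurable_pmax (h := fun t z => a t z.2 + h t z.1)).
  move=> t; apply: measurable_funD; last exact: measurableT_comp.
  apply: (@measurableT_comp _ _ _ _ _ _ (a t)) => //.
  rewrite /a; under eq_fun do rewrite big_mkcond/=.
  apply: measurable_sum => i; case: (i != j) => //.
  by apply: measurableT_comp => //; exact: measurable_tnth.
- by move=> z; rewrite lee_fin pmax_ge0.
Qed.

Let hybrid_step (j : 'I_k) : (hybrid j <= hybrid j.+1)%E.
Proof.
have hE l w : (fun t => \sum_(i < k) hybrid_term l i t (Xs i w)) =
    (fun t => (\sum_(i < k | i != j) hybrid_term l i t (Xs i w)) +
              hybrid_term l j t (Xs j w)).
  by apply/funext => t; rewrite (bigD1 j)//= addrC.
rewrite /hybrid.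
under eq_integral => w _ do rewrite hE.
under [leRHS]eq_integral => w _ do rewrite hE.
rewrite !hybrid_split//.
apply: ge0_integral_mono => w.
  by apply: integral_ge0 => w' _; rewrite lee_fin pmax_ge0.
(* Away from index [j] the two hybrids coincide; this common frozen sum plays the role of [a] in
   [symmetrization_step]. *)
have aE t : \sum_(i < k | i != j) hybrid_term j.+1 i t (Xs i w) =
    \sum_(i < k | i != j) hybrid_term j i t (Xs i w).
  by apply: eq_bigr => i ij; rewrite /hybrid_term ltnS leq_eqVlt val_eqE (negbTE ij).
under [leRHS]eq_integral => w' _ do under eq_fun => t do rewrite aE.
(* At index [j] the left hybrid still holds [m - p], while the right one already holds [v]. *)
rewrite /hybrid_term ltnn ltnSn.
apply: (@symmetrization_step _ _ _ P _ _ m (fun t w => p t (Xs j w))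
  (fun t w => v t (Xs j w))) => //.
- by move=> t; apply: measurableT_comp.
- by move=> t; apply: measurableT_comp.
Qed.

Lemma symmetrization_contraction :
  (\int[P]_w (pmax (fun t => \sum_(i < k) (m t - p t (Xs i w))))%:E <=
   \int[P]_w (pmax (fun t => \sum_(i < k) v t (Xs i w)))%:E)%E.
Proof.
have -> : (\int[P]_w (pmax (fun t => \sum_(i < k) (m t - p t (Xs i w))))%:E)%E =
    hybrid 0.
  by apply: eq_integral => w _; congr (pmax _)%:E.
have -> : (\int[P]_w (pmax (fun t => \sum_(i < k) v t (Xs i w)))%:E)%E = hybrid k.
  apply: eq_integral => w _; congr (pmax _)%:E; apply/funext => t.
  by apply: eq_bigr => i _; rewrite /hybrid_term ltn_ord.
suff: forall l, (l <= k)%N -> (hybrid 0 <= hybrid l)%E by exact.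
elim=> [//|l IH lk]; apply: le_trans (IH (ltnW lk)) _.
exact: (hybrid_step (Ordinal lk)).
Qed.

End process_comparison.

(** * Equality in law, vectors and separability *)

Lemma integral_same_law d (Omega : measurableType d) (R : realType)
    (P : probability Omega R) (n : nat) (X Y : {mfun Omega >-> n.-tuple R})
    (f : n.-tuple R -> \bar R) :
  same_law P X Y -> measurable_fun setT f -> (forall x, 0 <= f x)%E ->
  (\int[P]_w f (X w) = \int[P]_w f (Y w))%E.
Proof.
move=> XY mf f0.
transitivity (\int[distribution P X]_x f x)%E.
  by rewrite ge0_integral_pushforward.
rewrite (eq_measure_integral (distribution P Y)); last first.
  by move=> A mA _; exact: XY.
by rewrite ge0_integral_pushforward.
Qed.

Section vectors.
Context {R : realType} {n : nat}.
Implicit Types x y z : n.-tuple R.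

Lemma dotvC x y : dotv x y = dotv y x.
Proof. by apply: eq_bigr => j _; rewrite mulrC. Qed.

Lemma dotvDl x y z : dotv (addv x y) z = dotv x z + dotv y z.
Proof. by rewrite -big_split; apply: eq_bigr => j _; rewrite tnth_mktuple mulrDl. Qed.

Lemma dotvZl (a : R) x z : dotv (scalev a x) z = a * dotv x z.
Proof. by rewrite mulr_sumr; apply: eq_bigr => j _; rewrite tnth_mktuple mulrA. Qed.

Lemma dotvNl x z : dotv (oppv x) z = - dotv x z.
Proof. by rewrite -sumrN; apply: eq_bigr => j _; rewrite tnth_mktuple mulNr. Qed.

Lemma norm2Z (a : R) x : norm2 (scalev a x) = `|a| * norm2 x.
Proof.
rewrite /norm2 dotvZl dotvC dotvZl mulrA -expr2 sqrtrM ?sqr_ge0//.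
by rewrite sqrtr_sqr.
Qed.

Lemma measurable_dotv x : measurable_fun setT (dotv x).
Proof.
rewrite /dotv; apply: measurable_sum => j; apply: measurable_funM => //.
exact: measurable_tnth.
Qed.

Lemma measurable_oppv : measurable_fun setT (@oppv R n).
Proof.
apply/measurable_fun_tnthP => j.
rewrite (_ : _ \o _ = fun x => - tnth x j); last first.
  by apply/funext => x /=; rewrite tnth_mktuple.
by apply: measurableT_comp => //; exact: measurable_tnth.
Qed.

Lemma measurable_norm_dotv x : measurable_fun setT (fun y => `|dotv x y|).
Proof.
apply: (@measurableT_comp _ _ _ _ _ _ (@Num.norm R R)); first exact: normr_measurable.
exact: measurable_dotv.
Qed.

Lemma norm_dotvB_le (eps : R) x y z :
  (forall j, `|tnth x j - tnth y j| <= eps) ->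
  `|dotv y z| <= `|dotv x z| + eps * \sum_(j < n) `|tnth z j|.
Proof.
move=> xy; rewrite -lerBlDl; apply: (le_trans (lerB_dist _ _)).
rewrite /dotv -sumrB mulr_sumr; apply: (le_trans (ler_norm_sum _ _ _)).
apply: ler_sum => j _; rewrite -mulrBl normrM ler_wpM2r//.
by rewrite distrC.
Qed.

(** For each rational point and each precision, one point of [S] that close to it is chosen whenever
    there is one; such pairs are countable, so any set, measurable or not, is covered. *)
Lemma dense_sequence (S : set (n.-tuple R)) : S !=set0 ->
  exists2 f : nat -> n.-tuple R, forall j, S (f j) &
    forall t (eps : R), S t -> 0 < eps ->
      exists j, forall i, `|tnth (f j) i - tnth t i| <= eps.
Proof.
move=> [s0 Ss0].
pose near (q : n.-tuple rat * nat) (s : n.-tuple R) :=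
  S s /\ forall i, `|tnth s i - ratr (tnth q.1 i)| <= q.2.+1%:R^-1.
have [g gP] : {g : n.-tuple rat * nat -> n.-tuple R &
    forall q, S (g q) /\ ((exists s, near q s) -> near q (g q))}.
  apply: (@choice _ _ (fun q s => S s /\ ((exists s', near q s') -> near q s))) => q.
  have [[s qs]|nqs] := pselect (exists s, near q s); last by exists s0.
  by exists s; split => //; case: qs.
(* Codes that decode to no pair are sent to the default point [s0]. *)
exists (fun j => if unpickle j is Some q then g q else s0) => [j|t eps St eps0].
  by case: unpickle => // q; case: (gP q).
(* Half of [eps] is used twice: [t] and the chosen point of [S] are each this close to the same
   rational point. *)
have [M _ HM] : \forall M \near \oo, M.+1%:R^-1 < eps / 2 :> R.
  exact: (near_infty_natSinv_lt (PosNum (divr_gt0 eps0 (ltr0Sn R 1)))).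
have {}HM := HM M (leqnn M).
have [q qP] : {q : 'I_n -> rat &
    forall i, `|tnth t i - ratr (q i)| <= M.+1%:R^-1}.
  apply: (@choice _ _ (fun i q => `|tnth t i - ratr q| <= M.+1%:R^-1)) => i.
  have /rat_in_itvoo[q] : tnth t i < tnth t i + M.+1%:R^-1 by rewrite ltrDl.
  rewrite in_itv/= => /andP[tq qt]; exists q.
  by rewrite distrC ger0_norm; [rewrite lerBlDl ltW|rewrite subr_ge0 ltW].
exists (pickle (mktuple q, M)) => i; rewrite pickleK.
have [_ /(_ _)[|_ /(_ i)]] := gP (mktuple q, M).
  by exists t; split => // i'; rewrite /= tnth_mktuple.
rewrite /= tnth_mktuple => h1; have h2 := qP i.
have := ler_distD (ratr (q i)) (tnth (g (mktuple q, M)) i) (tnth t i).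
rewrite [`|ratr _ - _|]distrC.
by move: h1 h2 HM; move: (M.+1%:R^-1) => e; lra.
Qed.

End vectors.

HB.instance Definition _ (R : realType) (n : nat) :=
  isMeasurableFun.Build _ _ _ _ (@oppv R n) measurable_oppv.

(** * The Lipschitz cutoff *)

Section soft_threshold.
Context {R : realType} (delta : R).
Hypothesis delta0 : 0 < delta.

(** A Lipschitz substitute for the indicator of [delta <= |u|], as contraction requires; the ramp
    over [[delta / 2, delta]] has slope [2 / delta]. *)
Definition soft_threshold (u : R) : R :=
  Num.min 1 (Num.max 0 (2 / delta * `|u| - 1)).

Lemma soft_threshold_ge0 u : 0 <= soft_threshold u.
Proof. by rewrite /soft_threshold le_min ler01 le_max lexx. Qed.

Lemma soft_threshold_le1 u : soft_threshold u <= 1.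
Proof. by rewrite /soft_threshold ge_min lexx. Qed.

Lemma soft_threshold_eq0 u : `|u| <= delta / 2 -> soft_threshold u = 0.
Proof.
move=> ud; rewrite /soft_threshold max_l ?min_r//.
by rewrite subr_le0 mulrAC ler_pdivrMr// mul1r -ler_pdivlMl// mulrC.
Qed.

Lemma soft_threshold_eq1 u : delta <= `|u| -> soft_threshold u = 1.
Proof.
move=> ud; rewrite /soft_threshold min_l// le_max; apply/orP; right.
have : 1 <= delta^-1 * `|u| by rewrite ler_pdivlMl// mulr1.
by rewrite -mulrA; lra.
Qed.

Lemma soft_threshold_lipschitz u u' :
  `|soft_threshold u - soft_threshold u'| <= 2 / delta * `|u - u'|.
Proof.
have h : `|2 / delta * `|u| - 2 / delta * `|u'| | <= 2 / delta * `|u - u'|.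
  rewrite -mulrBr normrM (ger0_norm (ltW (divr_gt0 _ delta0)))//.
  by rewrite ler_pM2l ?divr_gt0// ler_dist_dist.
(* Clamping to the interval from 0 to 1 does not increase distances, so the bound on the unclamped
   ramp suffices. *)
apply: le_trans h; rewrite /soft_threshold.
move: (2 / delta * `|u|) (2 / delta * `|u'|) => a b.
rewrite /Num.min /Num.max.
repeat case: ifPn; rewrite -?leNgt => *;
  (case: (ger0P (a - b)) => ?; rewrite ler_norml; lra).
Qed.

Lemma norm_soft_threshold_le u : `|soft_threshold u| <= 2 / delta * `|u|.
Proof.
have := soft_threshold_lipschitz u 0.
suff -> : soft_threshold 0 = 0 by rewrite !subr0.
by apply: soft_threshold_eq0; rewrite normr0 divr_ge0// ltW.
Qed.

Lemma measurable_soft_threshold : measurable_fun setT soft_threshold.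
Proof.
apply: measurable_minr; first exact: measurable_cst.
apply: measurable_maxr; first exact: measurable_cst.
apply: measurable_funB; last exact: measurable_cst.
by apply: measurable_funM; [exact: measurable_cst|exact: normr_measurable].
Qed.

End soft_threshold.

(** * Small-ball estimate and norms of kernel points *)

Section small_ball_kernel.
Context {R : realType} {d} {Omega : measurableType d} (P : probability Omega R)
  (n k : nat) (X : {RV P >-> n.-tuple R}) (Xs : 'I_k -> {RV P >-> n.-tuple R})
  (lambda : R) (T : set (n.-tuple R)).
Hypothesis lambda0 : 0 < lambda.
Hypothesis k0 : (0 < k)%N.
Hypothesis symX : same_law P X (fun w => oppv (X w)).
Hypothesis small_ball : forall x : n.-tuple R,
  ((99%:R / 100%:R : R)%:E <=
   P [set w | (lambda * norm2 x <= `|dotv x (X w)|)%R])%E.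
Hypothesis lawXs : forall i, same_law P (Xs i) X.
Hypothesis indep : mutually_independent Xs.
Hypothesis T0 : T !=set0.

Let M : \bar R :=
  (\int[P]_u polar_norm_T T (normalized_sum (fun i => Xs i u)))%E.

(** A relaxed form of membership of [t] in the kernel; the tolerance leaves room to replace a kernel
    point by a nearby term of a dense sequence. *)
Definition small_on_sample (delta : R) (t : n.-tuple R) : set Omega :=
  [set w | forall i, `|dotv t (Xs i w)| <= delta].

Lemma measurable_small_on_sample delta t : measurable (small_on_sample delta t).
Proof.
rewrite (_ : small_on_sample _ _ = \bigcap_(i in [set: 'I_k])
    ((fun w => `|dotv t (Xs i w)|) @^-1` [set y | y <= delta])); last first.
  by apply/seteqP; split => [w h i _|w h i]; exact: h.
apply: fin_bigcap_measurable => // i _.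
rewrite -[X in measurable X]setTI -[X in _ @^-1` X]set_itvNyc.
by apply: (measurableT_comp (measurable_norm_dotv t) (measurable_funP (Xs i))).
Qed.

Lemma polar_norm_ge0 y : (0 <= polar_norm_T T y)%E.
Proof.
case: T0 => t Tt; apply: (@le_trans _ _ (`|dotv y t|)%:E); first by rewrite lee_fin.
by apply: ereal_sup_ubound; exists t.
Qed.

Lemma integral_polar_norm_ge0 : (0 <= M)%E.
Proof. by apply: integral_ge0 => w _; exact: polar_norm_ge0. Qed.

Lemma normalized_sumE w (t : n.-tuple R) :
  \sum_(i < k) dotv t (Xs i w) =
  Num.sqrt k%:R * dotv (normalized_sum (fun i => Xs i w)) t.
Proof.
have sk : Num.sqrt (k%:R : R) != 0 by rewrite sqrtr_eq0 -ltNge ltr0n.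
rewrite /dotv exchange_big/= mulr_sumr; apply: eq_bigr => j _.
by rewrite tnth_mktuple -mulr_sumr -!mulrA mulVKf// mulrC.
Qed.

(** Markov's inequality for the maximum of the centred cutoff sums, whose expectation is bounded
    through symmetrization and contraction. *)
Lemma small_ball_finite (r : R) (N : nat) (F : 'I_N -> n.-tuple R) : 0 < r ->
  (forall t, T (F t)) -> (forall t, r <= norm2 (F t)) ->
  ((99%:R / 100%:R * k%:R)%:E *
     P (\bigcup_(t in [set: 'I_N]) small_on_sample (lambda * r / 2) (F t)) <=
   (4 / (lambda * r) * Num.sqrt k%:R)%:E * M)%E.
Proof.
move=> r0 TF rF; set delta := lambda * r.
have delta0 : 0 < delta by rewrite mulr_gt0.
pose p t x := soft_threshold delta (dotv (F t) x).
(* The factor [4 / delta] is twice the Lipschitz constant of the cutoff, matching the factor 2 in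
   the contraction hypotheses. *)
pose v t x := 4 / delta * dotv (F t) x.
have mp t : measurable_fun setT (p t).
  apply: (@measurableT_comp _ _ _ _ _ _ (soft_threshold delta)).
    exact: measurable_soft_threshold.
  exact: measurable_dotv.
have mv t : measurable_fun setT (v t).
  apply: measurable_funM; first exact: measurable_cst.
  exact: measurable_dotv.
have mpX t (Y : {RV P >-> n.-tuple R}) : measurable_fun setT (fun w => p t (Y w)).
  by apply: (@measurableT_comp _ _ _ _ _ _ (p t)) => //; exact: measurable_funP.
have mvX t (Y : {RV P >-> n.-tuple R}) : measurable_fun setT (fun w => v t (Y w)).
  by apply: (@measurableT_comp _ _ _ _ _ _ (v t)) => //; exact: measurable_funP.
pose m t := fine (\int[P]_w (p t (X w))%:E)%E.
have pX t : (\int[P]_w (p t (X w))%:E = (m t)%:E)%E.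
  rewrite fineK// ge0_fin_numE; last first.
    by apply: integral_ge0 => w _; rewrite lee_fin soft_threshold_ge0.
  apply: (@le_lt_trans _ _ (\int[P]_w 1%:E)%E); last first.
    by rewrite (integral_prob_cst P) ltry.
  apply: ge0_integral_mono => w; rewrite lee_fin ?soft_threshold_ge0//.
  exact: soft_threshold_le1.
have pm i t : (\int[P]_w (p t (Xs i w))%:E = (m t)%:E)%E.
  rewrite -pX; apply: (integral_same_law (f := fun x => (p t x)%:E)) => //.
    exact/measurable_EFinP.
  by move=> x; rewrite lee_fin soft_threshold_ge0.
(* As [delta] is at most [lambda * norm2 (F t)], the cutoff equals 1 on the small-ball event, so its
   mean is at least the probability of that event. *)
have m99 t : 99%:R / 100%:R <= m t.
  rewrite -lee_fin -pX; apply: (le_trans (small_ball (F t))).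
  have mS : measurable [set w | lambda * norm2 (F t) <= `|dotv (F t) (X w)|].
    rewrite (_ : [set _ | _] = (fun w => `|dotv (F t) (X w)|) @^-1`
      [set y | lambda * norm2 (F t) <= y])// -[X in measurable X]setTI -set_itvcy.
    by apply: (measurableT_comp (measurable_norm_dotv (F t)) (measurable_funP X)).
  rewrite -[X in P X]setIT -integral_indic//.
  apply: ge0_integral_mono => w; rewrite lee_fin ?indicE//.
  case: (boolP (w \in _)) => [|_]; last exact: soft_threshold_ge0.
  rewrite inE/= => h; rewrite /p soft_threshold_eq1//.
  by apply: le_trans h; rewrite ler_pM2l.
have key : (\int[P]_w (pmax (fun t => \sum_(i < k) (m t - p t (Xs i w))))%:E <=
   \int[P]_w (pmax (fun t => \sum_(i < k) v t (Xs i w)))%:E)%E.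
  apply: (symmetrization_contraction (p := p) indep mp mv _ pm).
  - by move=> t x; exact: soft_threshold_ge0.
  - move=> t x; apply: (le_trans (ler_wpM2l _ (norm_soft_threshold_le delta0 _))) => //.
    rewrite normrM (@ger0_norm _ (4 / delta)) ?divr_ge0//; last exact: ltW.
    by rewrite mulrA mulrA -natrM.
  - move=> t s x.
    apply: (le_trans (ler_wpM2l _ (soft_threshold_lipschitz delta0 _ _))) => //.
    rewrite -mulrBr normrM (@ger0_norm _ (4 / delta)) ?divr_ge0//; last exact: ltW.
    by rewrite mulrA mulrA -natrM.
  (* The form [v t] is odd and [Xs i] has the symmetric law of [X], so the sign of [v] can be
     flipped under the integral. *)
  - move=> i a.
    pose f x := (pmax (fun t => a t + v t x))%:E.
    pose g x := (pmax (fun t => a t - v t x))%:E.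
    have mf : measurable_fun setT f.
      apply/measurable_EFinP; apply: (measurable_pmax (h := fun t x => a t + v t x)).
      by move=> t; apply: measurable_funD.
    have mg : measurable_fun setT g.
      apply/measurable_EFinP; apply: (measurable_pmax (h := fun t x => a t - v t x)).
      by move=> t; apply: measurable_funB.
    have f0 x : (0 <= f x)%E by rewrite lee_fin pmax_ge0.
    have g0 x : (0 <= g x)%E by rewrite lee_fin pmax_ge0.
    rewrite (integral_same_law (lawXs i) mf f0) (integral_same_law (lawXs i) mg g0).
    rewrite (integral_same_law (Y := [the {mfun _ >-> _} of @oppv R n \o X])
      symX mf f0).
    apply: eq_integral => w _; congr (pmax _)%:E; apply/funext => t.
    by rewrite /v /= (dotvC _ (oppv _)) dotvNl dotvC mulrN.
set bad := \bigcup_(t in _) _.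
have mbad : measurable bad.
  by apply: fin_bigcup_measurable => // t _; exact: measurable_small_on_sample.
pose c := 4 / delta * Num.sqrt (k%:R : R).
have c0 : 0 < c by rewrite mulr_gt0 ?divr_gt0// sqrtr_gt0 ltr0n.
(* On [bad], some [t] has zero cutoff at every sample point; its centred sum is then [k * m t], at
   least [99 k / 100]. *)
apply: (@le_trans _ _
    (\int[P]_w (pmax (fun t => \sum_(i < k) (m t - p t (Xs i w))))%:E)%E).
  have k99 : 0 <= 99%:R / 100%:R * k%:R :> R by rewrite mulr_ge0// divr_ge0.
  rewrite -[X in (_ * P X)%E]setIT -integral_indic//.
  rewrite -ge0_integralZl_EFin//; last exact/measurable_EFinP.
  apply: ge0_integral_mono => w; first by rewrite -EFinM lee_fin mulr_ge0.
  rewrite -EFinM lee_fin indicE; case: (boolP (w \in _)) => [|_]; last by rewrite mulr0 pmax_ge0.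
  rewrite inE mulr1 => -[t _ tw]; apply: le_trans (le_pmax _ t).
  under eq_bigr => i _ do rewrite /p soft_threshold_eq0// subr0.
  by rewrite sumr_const card_ord -[leRHS]mulr_natr ler_wpM2r.
apply: (le_trans key).
have -> : (\int[P]_w (pmax (fun t => \sum_(i < k) v t (Xs i w)))%:E =
    c%:E * \int[P]_w (c^-1 * pmax (fun t => \sum_(i < k) v t (Xs i w)))%:E)%E.
  rewrite -ge0_integralZl_EFin//; last exact: ltW.
  - by apply: eq_integral => w _; rewrite -EFinM mulVKf ?gt_eqF.
  - by move=> w _; rewrite lee_fin mulr_ge0 ?invr_ge0 ?pmax_ge0// ltW.
  - apply/measurable_EFinP; apply: measurable_funM; first exact: measurable_cst.
    apply: (measurable_pmax (h := fun t w => \sum_(i < k) v t (Xs i w))) => t.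
    by apply: measurable_sum => i; exact: mvX.
rewrite lee_pmul2l//; apply: ge0_integral_mono => w.
  by rewrite lee_fin mulr_ge0 ?invr_ge0 ?pmax_ge0// ltW.
have [->|[t ->]] := pmax_attained (fun t => \sum_(i < k) v t (Xs i w)).
  by rewrite mulr0 polar_norm_ge0.
rewrite -mulr_sumr normalized_sumE (mulrA (4 / delta)) -/c mulKf ?gt_eqF//.
apply: (@le_trans _ _ (`|dotv (normalized_sum (fun i => Xs i w)) (F t)|)%:E).
  by rewrite lee_fin ler_norm.
by apply: ereal_sup_ubound; exists (F t).
Qed.

(** The bound for finitely many points does not depend on their number, so it passes to the
    countable union by continuity from below. *)
Lemma small_ball_countable (r M0 : R) (f : nat -> n.-tuple R) : 0 < r ->
  (forall j, T (f j)) -> (forall j, r <= norm2 (f j)) -> M = M0%:E ->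
  (P (\bigcup_j small_on_sample (lambda * r / 2) (f j)) <=
   (5 * M0 / (lambda * r * Num.sqrt k%:R))%:E)%E.
Proof.
move=> r0 Tf rf ME.
pose B j := small_on_sample (lambda * r / 2) (f j).
have mB j : measurable (B j) by exact: measurable_small_on_sample.
pose U N := \bigcup_(j in `I_N) B j.
have mU N : measurable (U N) by exact: bigcup_measurable.
have UE : \bigcup_N U N = \bigcup_j B j.
  apply/seteqP; split => w [j _].
    by move=> [j' _ Bw]; exists j'.
  by move=> Bw; exists j.+1 => //; exists j => /=.
rewrite -/B -UE.
have M00 : 0 <= M0 by rewrite -lee_fin -ME integral_polar_norm_ge0.
have sk : 0 < Num.sqrt (k%:R : R) by rewrite sqrtr_gt0 ltr0n.
have UP N : (P (U N) <= (5 * M0 / (lambda * r * Num.sqrt k%:R))%:E)%E.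
  have := @small_ball_finite r N (fun t => f t) r0 (fun t => Tf t) (fun t => rf t).
  rewrite (_ : \bigcup_(t in [set: 'I_N]) _ = U N); last first.
    apply/seteqP; split => w [j jN Bw]; first by exists j => /=.
    by exists (Ordinal jN).
  have fP : P (U N) \is a fin_num by exact: fin_num_measure.
  rewrite ME -(fineK fP) -!EFinM !lee_fin.
  have : 0 <= fine (P (U N)) by rewrite fine_ge0.
  move: (fine _) => x x0.
  have kE : k%:R = Num.sqrt k%:R * Num.sqrt k%:R :> R.
    by rewrite -expr2 sqr_sqrtr.
  rewrite {1}kE; move: sk; move: (Num.sqrt _) => s s0.
  have lr : 0 < lambda * r by rewrite mulr_gt0.
  move: lr; move: (lambda * r) => e e0 h.
  rewrite ler_pdivlMr ?mulr_gt0//.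
  (* Writing [k] as [s * s] cancels one factor [s]; the remaining constant [400 / 99] is then
     rounded up to 5. *)
  have {}h : 99%:R / 100%:R * (x * (e * s)) <= 4 * M0.
    rewrite -(@ler_pM2r _ (s / e)) ?divr_gt0//.
    apply: le_trans (le_trans h _); rewrite le_eqVlt; apply/orP; left; apply/eqP.
      by field; rewrite gt_eqF.
    by field; rewrite gt_eqF.
  lra.
have cvgU : P (U N) @[N --> \oo] --> P (\bigcup_N U N).
  apply: (nondecreasing_cvg_mu (mu := P)) => //.
    exact: bigcup_measurable.
  move=> N N' NN'; apply/subsetPset => w [j /= jN Bw].
  by exists j => //=; exact: leq_trans NN'.
rewrite -(cvg_lim _ cvgU)//; apply: lime_le; first by apply/cvg_ex; eexists; exact: cvgU.
by apply: nearW => N; exact: UP.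
Qed.

(** The bad event is a countable union over a dense sequence in the points of [T] of norm at least
    [r]: a kernel point among these would make a nearby term of the sequence small on the whole
    sample. *)
Lemma kernel_norm_lt (r M0 : R) : 0 < r -> M = M0%:E ->
  exists B : set Omega, [/\ measurable B,
    (P B <= (5 * M0 / (lambda * r * Num.sqrt k%:R))%:E)%E &
    forall w t, ~ B w -> T t -> kerGamma (fun i => Xs i w) t -> norm2 t < r].
Proof.
move=> r0 ME.
have sk : 0 < Num.sqrt (k%:R : R) by rewrite sqrtr_gt0 ltr0n.
have [S0|nS0] := pselect ([set t | T t /\ r <= norm2 t] !=set0); last first.
  exists set0; split => //.
    rewrite measure0 lee_fin divr_ge0//; last first.
      by rewrite !mulr_ge0// ltW.
    by rewrite mulr_ge0// -lee_fin -ME integral_polar_norm_ge0.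
  move=> w t _ Tt _; rewrite ltNge; apply/negP => rt.
  by apply: nS0; exists t.
have [f Sf dense] := dense_sequence S0.
exists (\bigcup_j small_on_sample (lambda * r / 2) (f j)); split.
- by apply: bigcup_measurable => j _; exact: measurable_small_on_sample.
- by apply: small_ball_countable => // j; case: (Sf j).
move=> w t nB Tt kert; rewrite ltNge; apply/negP => rt; apply: nB.
(* [C] bounds the sum of absolute coordinates of every [Xs i w], so the precision [eps], which
   depends on [w], keeps all inner products within [lambda * r / 2]; the added 1 makes the divisor
   positive. *)
pose C := \sum_(i < k) \sum_(j < n) `|tnth (Xs i w) j|.
have C0 : 0 <= C by rewrite sumr_ge0// => i _; rewrite sumr_ge0.
have C1 : 0 < 1 + C by rewrite ltr_pwDl.
pose eps := lambda * r / 2 / (1 + C).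
have eps0 : 0 < eps by rewrite !divr_gt0// mulr_gt0.
have [j jP] := dense t eps (conj Tt rt) eps0.
exists j => // i.
have tX : dotv t (Xs i w) = 0.
  have := congr1 (fun y => tnth y i) kert; rewrite !tnth_mktuple => /eqP.
  by rewrite mulf_eq0 invr_eq0 gt_eqF//= dotvC => /eqP.
apply: (le_trans (@norm_dotvB_le _ _ eps t _ _ _)) => [j'|].
  by rewrite distrC.
rewrite tX normr0 add0r.
have XC : \sum_(j < n) `|tnth (Xs i w) j| <= 1 + C.
  rewrite /C (bigD1 i)//= addrCA lerDl addr_ge0//.
  by rewrite sumr_ge0// => i' _; rewrite sumr_ge0.
apply: (le_trans (ler_wpM2l (ltW eps0) XC)).
by rewrite /eps divfK// gt_eqF.
Qed.

(* When [M0 = 0] no radius is admissible, and one lets [r] tend to 0. *)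
Lemma kernel_norm_le (M0 : R) : M = M0%:E ->
  exists A : set Omega, [/\ measurable A, ((3%:R / 4%:R : R)%:E <= P A)%E &
    forall w t, A w -> T t -> kerGamma (fun i => Xs i w) t ->
      norm2 t <= 20 / lambda * M0 / Num.sqrt k%:R].
Proof.
move=> ME.
have sk : 0 < Num.sqrt (k%:R : R) by rewrite sqrtr_gt0 ltr0n.
have M00 : 0 <= M0 by rewrite -lee_fin -ME integral_polar_norm_ge0.
suff [B [mB PB ker]] : exists B : set Omega, [/\ measurable B,
    (P B <= (1 / 4)%:E)%E &
    forall w t, ~ B w -> T t -> kerGamma (fun i => Xs i w) t ->
      norm2 t <= 20 / lambda * M0 / Num.sqrt k%:R].
  exists (~` B); split => [||w t nBw]; [exact: measurableC| |exact: ker].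
  have fP : P B \is a fin_num by exact: fin_num_measure.
  rewrite probability_setC//; move: PB.
  by rewrite -(fineK fP) -EFinB !lee_fin; lra.
move: M00; rewrite le_eqVlt => /predU1P[M00|M00].
  have r0 m : 0 < m.+1%:R^-1 :> R by rewrite invr_gt0.
  have [B BP] := choice (fun m => kernel_norm_lt (r0 m) ME).
  exists (\bigcup_m B m); split.
  - by apply: bigcup_measurable => m _; case: (BP m).
  (* With [M0 = 0] the probability bound vanishes at every radius, so each [B m] is null and so is
     their union. *)
  - suff -> : P (\bigcup_m B m) = 0%E by rewrite lee_fin divr_ge0.
    apply/eqP; rewrite -measure_le0; apply: (@le_trans _ _ (\sum_(m <oo) P (B m))%E).
      apply: measure_sigma_subadditive => //; first by move=> m; case: (BP m).
      by apply: bigcup_measurable => m _; case: (BP m).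
    rewrite eseries0// => m _ _; apply/eqP; rewrite -measure_le0.
    by case: (BP m) => _; rewrite -M00 mulr0 mul0r.
  - move=> w t nB Tt kert; rewrite -M00 mulr0 mul0r leNgt; apply/negP => t0.
    have [m _ /(_ m (leqnn m)) Hm] := near_infty_natSinv_lt (PosNum t0).
    have [_ _ /(_ w t)] := BP m.
    suff nBm : ~ B m w by move=> /(_ nBm Tt kert); rewrite ltNge (ltW Hm).
    by move=> Bw; apply: nB; exists m.
(* At this radius the bound [5 * M0 / (lambda * r * sqrt k)] equals exactly [1 / 4]. *)
have r0 : 0 < 20 / lambda * M0 / Num.sqrt k%:R by rewrite divr_gt0// mulr_gt0// divr_gt0.
have [B [mB PB ker]] := kernel_norm_lt r0 ME.
exists B; split => // [|w t nB Tt kert]; last exact/ltW/(ker w).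
rewrite (le_trans PB)// lee_fin le_eqVlt; apply/orP; left; apply/eqP.
by field; rewrite !gt_eqF.
Qed.

End small_ball_kernel.

(** * From norms to the diameter, and the final estimate *)

(** Half the difference of two points of the section lies in [T] by symmetry and convexity, and in
    the kernel by linearity, so its norm is at most [r]. *)
Lemma l2diam_kernel_le {R : realType} {n k : nat} (T : set (n.-tuple R))
    (Ys : 'I_k -> n.-tuple R) (r : R) : convex_body T ->
  (forall t, T t -> kerGamma Ys t -> norm2 t <= r) ->
  (l2diam (T `&` kerGamma Ys) <= (2 * r)%:E)%E.
Proof.
move=> [Tconv Tsym _] ker; apply: ge_ereal_sup => _ [x [Tx kx] [y [Ty ky] <-]].
pose z := scalev (1 / 2) (addv x (oppv y)).
have zE : z = addv (scalev (1 / 2) x) (scalev (1 - 1 / 2) (oppv y)).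
  by apply: eq_from_tnth => j; rewrite !tnth_mktuple; field.
have Tz : T z by rewrite zE; apply: Tconv => //; [exact: Tsym|lra].
have kz : kerGamma Ys z.
  apply: eq_from_tnth => i.
  have := congr1 (fun y => tnth y i) kx; have := congr1 (fun y => tnth y i) ky.
  rewrite !tnth_mktuple => hy hx.
  by rewrite dotvC dotvZl dotvDl dotvNl mulrCA mulrBr !(dotvC _ (Ys i)) hx hy subrr mulr0.
have := ker z Tz kz; rewrite /z norm2Z lee_fin ger0_norm//; lra.
Qed.

Unset Implicit Arguments.

Theorem theorem1p3 (R : realType) (lambda : R) (hlambda : 0 < lambda) :
  exists c : R, 0 < c /\
  forall (n k : nat), (0 < n)%N -> (0 < k)%N ->
  forall (d : measure_display) (Omega : measurableType d) (P : probability Omega R)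
         (X : {RV P >-> n.-tuple R}) (Xs : 'I_k -> {RV P >-> n.-tuple R}),
  isotropic X ->
  (forall x : n.-tuple R,
     ((99%:R / 100%:R : R)%:E <= P [set w | (lambda * norm2 x <= `|dotv x (X w)|)%R])%E) ->
  (forall i, same_law P (Xs i) X) ->
  mutually_independent Xs ->
  forall (d' : measure_display) (Omega' : measurableType d') (Q : probability Omega' R)
         (G : {RV Q >-> n.-tuple R}),
  std_gaussian G ->
  forall T : set (n.-tuple R), convex_body T ->
  exists A : set Omega, measurable A /\
    ((3%:R / 4%:R : R)%:E <= P A)%E /\
    (forall w, A w ->
       (l2diam (T `&` kerGamma (fun i => Xs i w)) <=
        (c / Num.sqrt k%:R)%:E *
          maxe (\int[Q]_v polar_norm_T T (G v))
               (\int[P]_u polar_norm_T T (normalized_sum (fun i => Xs i u))))%E).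
Proof.
(* The constant is twice the 20 of [kernel_norm_le], the diameter being at most twice the radius. *)
exists (40 / lambda); split; first by rewrite divr_gt0.
move=> n k n0 k0 d Omega P X Xs [symX _] small_ball lawXs indep d' Omega' Q G _ T.
move=> convT.
(* The centre of a ball contained in [T] is a point of [T]. *)
have T0 : T !=set0.
  case: convT => _ _ [x [r [r0 rT]]]; exists x; apply: rT.
  suff -> : addv x (oppv x) = scalev 0 x by rewrite norm2Z normr0 mul0r.
  by apply: eq_from_tnth => j; rewrite !tnth_mktuple subrr mul0r.
set EG := (\int[Q]_v _)%E; set M := (\int[P]_u _)%E.
have c0 : 0 < 40 / lambda / Num.sqrt k%:R.
  by rewrite !divr_gt0// sqrtr_gt0 ltr0n.
have M0 : (0 <= M)%E by exact: integral_polar_norm_ge0.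
(* If the expectation is infinite, so is the right-hand side, and the whole space serves as the
   event. *)
have [Moo|Mfin] := eqVneq M +oo%E.
  exists setT; split; first exact: measurableT.
  split; first by rewrite probability_setT lee_fin ler_pdivrMr// mul1r ler_nat.
  move=> w _; rewrite (_ : maxe _ _ = +oo%E) ?gt0_muley ?lte_fin// ?leey//.
  by rewrite Moo; apply/max_idPr; rewrite leey.
have MM : M = (fine M)%:E by rewrite fineK// ge0_fin_numE// ltey.
have [A [mA PA ker]] := kernel_norm_le hlambda k0 symX small_ball lawXs indep T0 MM.
exists A; split => //; split => // w Aw.
apply: (le_trans (l2diam_kernel_le convT (fun t => ker w t Aw))).
apply: (@le_trans _ _ ((40 / lambda / Num.sqrt k%:R)%:E * M)%E).
  rewrite {2}MM -EFinM lee_fin le_eqVlt; apply/orP; left; apply/eqP.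
  by field; rewrite !gt_eqF// sqrtr_gt0 ltr0n.
by apply: lee_wpmul2l; [rewrite lee_fin ltW|rewrite le_max lexx orbT].
Qed.
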